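(* Let $f_1=f_1(\mathbf q,\dot{\mathbf q},t)$ be twice continuously differentiable on $\mathbb R^N\times\mathbb R^N\times[0,1]$, let $A:\mathbb R^N\times[0,1]\to\mathbb R^{P\times N}$ be twice continuously differentiable, and let $W\in\mathbb R^{P\times P}$ be a constant symmetric positive definite matrix. Fix $\mathbf q_0,\mathbf q_1\in\mathbb R^N$. Define $$J_1[\mathbf q]=\int_0^1 f_1(\mathbf q,\dot{\mathbf q},t)\,dt,\qquad J_2[\boldsymbol\theta,\mathbf q]=\int_0^1\Big\{f_1(\mathbf q,\dot{\mathbf q},t)+\tfrac12\big\|\dot{\boldsymbol\theta}-A(\mathbf q,t)\dot{\mathbf q}\big\|_W^2\Big\}\,dt .$$ Suppose that $\mathbf q^*$ is an extremal of $J_1$ (a solution of its Euler–Lagrange equations) that globally minimizes $J_1$ subject to $\mathbf q(0)=\mathbf q_0$, $\mathbf q(1)=\mathbf q_1$. Then, when no boundary conditions are imposed on $\boldsymbol\theta$, there is a family of global minimizers of $J_2$ (subject to $\mathbf q(0)=\mathbf q_0$, $\mathbf q(1)=\mathbf q_1$), parameterized by $\mathbf b\in\mathbb R^P$, of the form $(\mathbf q^*,\boldsymbol\theta^*_{\mathbf b})$ where $$\boldsymbol\theta^*_{\mathbf b}(t)=\mathbf b+\int_0^t A(\mathbf q^*(\tau),\tau)\,\dot{\mathbf q}^*(\tau)\,d\tau ,\qquad t\in[0,1].$$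
   Context: Trajectories are $\mathbf q:[0,1]\to\mathbb R^N$ and $\boldsymbol\theta:[0,1]\to\mathbb R^P$, taken to be twice continuously differentiable, and dots denote $d/dt$. For a column vector (or matrix) $B$, $\|B\|_W^2=\mathrm{tr}(B^TWB)$. The Euler–Lagrange equations of $J_1$ are $\frac{d}{dt}\frac{\partial f_1}{\partial\dot q_i}-\frac{\partial f_1}{\partial q_i}=0$ for $i=1,\dots,N$. *)

(* Defs.v *)
From HB Require Import structures.
From mathcomp Require Import all_boot all_order all_algebra.
From mathcomp Require Import all_classical all_reals all_analysis.

Set Implicit Arguments.
Unset Strict Implicit.
Unset Printing Implicit Defensive.

Import Order.TTheory GRing.Theory Num.Theory.
Import numFieldNormedType.Exports.

Local Open Scope classical_set_scope.
Local Open Scope ring_scope.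

(* Differentiability on a set K that need not be open.  The library's [derive]
   looks at a full neighbourhood of x; here the increment h is restricted to
   x + h v in K, so that on [0, 1] one gets the two-sided derivative inside and
   the one-sided derivatives at 0 and 1, and values of f outside K are
   irrelevant.  Only meaningful when K is convex with nonempty interior, which
   makes the filter below proper at every point of K and in every direction. *)
Section DifferentiabilityWithin.
Context {R : realType} {V W : normedModType R}.
Implicit Types (K : set V) (f : V -> W) (x v : V).

Definition diff_quotient f x v (h : R) : W := h^-1 *: (f (x + h *: v) - f x).

Definition derive_within K f v x : W :=
  lim (diff_quotient f x v @ within [set h | K (x + h *: v)] 0^').

Definition derivable_within K f v x : Prop :=
  cvg (diff_quotient f x v @ within [set h | K (x + h *: v)] 0^').

(* Class C^n on K: the iterated directional derivatives (within K, in all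
   directions, hence all partial derivatives) of order at most n exist and are
   continuous on K. *)
Fixpoint class_C (n : nat) K f : Prop :=
  {within K, continuous f} /\
  if n is n'.+1 then
    forall v, (forall x, K x -> derivable_within K f v x) /\
              class_C n' K (derive_within K f v)
  else True.

End DifferentiabilityWithin.

Section VariationalProblem.
Context {R : realType} {N P : nat}.

Definition unit_interval : set R := `[0, 1]%classic.

Definition time_derivative {W : normedModType R} (g : R -> W) (t : R) : W :=
  derive_within (V := R^o) unit_interval g 1 t.

Definition time_derivable {W : normedModType R} (g : R -> W) (t : R) : Prop :=
  derivable_within (V := R^o) unit_interval g 1 t.

Definition trajectory {n : nat} (g : R -> 'cV[R]_n) : Prop :=
  class_C (V := R^o) 2 unit_interval g.

Definition C2_lagrangian (f : 'cV[R]_N -> 'cV[R]_N -> R -> R) : Prop :=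
  class_C (V := ('cV[R]_N * 'cV[R]_N * R^o)%type) (W := R^o) 2
    [set x | unit_interval x.2] (fun x => f x.1.1 x.1.2 x.2).

Definition C2_matrix_field (A : 'cV[R]_N -> R -> 'M[R]_(P, N)) : Prop :=
  class_C (V := ('cV[R]_N * R^o)%type) 2
    [set x | unit_interval x.2] (fun x => A x.1 x.2).

Definition symmetric_posdef (W : 'M[R]_P) : Prop :=
  W^T = W /\ forall x : 'cV[R]_P, x != 0 -> 0 < (x^T *m W *m x) 0 0.

Definition sqnormW {k : nat} (W : 'M[R]_P) (B : 'M[R]_(P, k)) : R :=
  \tr (B^T *m W *m B).

Definition integral_vec {n : nat} (D : set R) (g : R -> 'cV[R]_n) : 'cV[R]_n :=
  \col_i \int[lebesgue_measure]_(t in D) g t i 0.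

Definition partial_position (f : 'cV[R]_N -> 'cV[R]_N -> R -> R) (i : 'I_N)
    (x v : 'cV[R]_N) (t : R) : R :=
  'D_(delta_mx i 0) (fun y => f y v t : R^o) x.

Definition partial_velocity (f : 'cV[R]_N -> 'cV[R]_N -> R -> R) (i : 'I_N)
    (x v : 'cV[R]_N) (t : R) : R :=
  'D_(delta_mx i 0) (fun w => f x w t : R^o) v.

Definition J1 (f : 'cV[R]_N -> 'cV[R]_N -> R -> R) (q : R -> 'cV[R]_N) : R :=
  \int[lebesgue_measure]_(t in unit_interval) f (q t) (time_derivative q t) t.

Definition J2 (f : 'cV[R]_N -> 'cV[R]_N -> R -> R)
    (A : 'cV[R]_N -> R -> 'M[R]_(P, N)) (W : 'M[R]_P)
    (theta : R -> 'cV[R]_P) (q : R -> 'cV[R]_N) : R :=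
  \int[lebesgue_measure]_(t in unit_interval)
    (f (q t) (time_derivative q t) t +
     2^-1 * sqnormW W (time_derivative theta t
                       - A (q t) t *m time_derivative q t)).

Definition extremal_J1 (f : 'cV[R]_N -> 'cV[R]_N -> R -> R)
    (q : R -> 'cV[R]_N) : Prop :=
  trajectory q /\
  forall (i : 'I_N) (t : R), unit_interval t ->
    let p := fun s => partial_velocity f i (q s) (time_derivative q s) s : R^o in
    time_derivable p t /\
    time_derivative p t
      - partial_position f i (q t) (time_derivative q t) t = 0.

Definition admissible (q0 q1 : 'cV[R]_N) (q : R -> 'cV[R]_N) : Prop :=
  [/\ trajectory q, q 0 = q0 & q 1 = q1].

Definition global_minimizer_J1 (f : 'cV[R]_N -> 'cV[R]_N -> R -> R)
    (q0 q1 : 'cV[R]_N) (q : R -> 'cV[R]_N) : Prop :=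
  admissible q0 q1 q /\ forall q', admissible q0 q1 q' -> J1 f q <= J1 f q'.

(* theta ranges over all C^2 trajectories: its endpoints are free. *)
Definition global_minimizer_J2 (f : 'cV[R]_N -> 'cV[R]_N -> R -> R)
    (A : 'cV[R]_N -> R -> 'M[R]_(P, N)) (W : 'M[R]_P) (q0 q1 : 'cV[R]_N)
    (q : R -> 'cV[R]_N) (theta : R -> 'cV[R]_P) : Prop :=
  [/\ admissible q0 q1 q, trajectory theta &
      forall q' theta', admissible q0 q1 q' -> trajectory theta' ->
        J2 f A W theta q <= J2 f A W theta' q'].

Definition theta_star (A : 'cV[R]_N -> R -> 'M[R]_(P, N)) (q : R -> 'cV[R]_N)
    (b : 'cV[R]_P) (t : R) : 'cV[R]_P :=
  b + integral_vec `[0, t] (fun s => A (q s) s *m time_derivative q s).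

End VariationalProblem.

(* Main.v *)
Require Import Defs.
From mathcomp Require Import all_boot all_order all_algebra.
From mathcomp Require Import all_classical all_reals all_analysis.
From mathcomp Require Import lra.

(** Let qs be the given minimizer and thetas = [theta_star A qs b].  Discarding
    the nonnegative penalty gives J1(q) <= J2(theta, q) for all C^2 trajectories
    ([J1_le_J2]).  The curve thetas is a primitive of A(qs, t) qs', so its penalty
    vanishes identically and J2(thetas, qs) = J1(qs) ([J2_theta_star]).  As qs
    minimizes J1, for every admissible q and every theta
      J2(thetas, qs) = J1(qs) <= J1(q) <= J2(theta, q).

    The analytic work is to see that thetas is itself an admissible competitor,
    that is, of class C^2 on [0, 1] including the one-sided derivatives at the
    endpoints ([trajectory_theta_star]).  Its first derivative is
    g(t) = A(qs(t), t) qs'(t), by the fundamental theorem of calculus; so g has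
    to be C^1.  That is the product rule together with the chain rule for
    t |-> A(qs(t), t), where A is only known through directional derivatives
    within the slab R^N x [0, 1] that are continuous there.  The chain rule
    ([time_derivative_chain]) moves from (q(t), t) to (q(t + h), t + h) first in
    time and then one position coordinate at a time.  Moves in position
    never leave the slab, so the mean value theorem applies to each of these
    steps ([slope_along]), and the time step starts from the fixed point
    (q(t), t), where its slope converges to the derivative within the slab by
    definition. *)

Set Implicit Arguments.
Unset Strict Implicit.
Unset Printing Implicit Defensive.

Import Order.TTheory GRing.Theory Num.Theory.
Import numFieldNormedType.Exports.

Local Open Scope classical_set_scope.
Local Open Scope ring_scope.

(** * Limits of matrices *)

Section MatrixLimits.
Context {R : realType} {T : Type} {F : set_system T} {FF : Filter F}.

Lemma cvg_mxP m n (f : T -> 'M[R]_(m, n)) (M : 'M[R]_(m, n)) :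
  f @ F --> M <-> forall i j, f x i j @[x --> F] --> M i j.
Proof.
split=> [fM i j|fM].
  apply: (@cvg_comp _ _ _ f (fun N : 'M[R]_(m, n) => N i j) _ _ _ fM).
  exact: coord_continuous.
move=> A [P MP PA]; apply: (@filterS _ F _ (fun x => forall i j, P i j (f x i j))).
  by move=> x Px; exact: PA.
apply: (@filter_forall T 'I_m (fun i x => forall j, P i j (f x i j))) => i.
apply: (@filter_forall T 'I_n (fun j x => P i j (f x i j))) => j.
exact: (fM i j _ (MP i j)).
Qed.

Lemma cvg_sum {V : normedModType R} (I : Type) (r : seq I) (f : I -> T -> V)
    (l : I -> V) :
  (forall i, f i x @[x --> F] --> l i) ->
  \sum_(i <- r) f i x @[x --> F] --> \sum_(i <- r) l i.
Proof. by move=> fl; apply: cvg_big => //; exact: add_continuous. Qed.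

Lemma cvg_mulmx m n p (f : T -> 'M[R]_(m, n)) (g : T -> 'M[R]_(n, p))
    (M : 'M[R]_(m, n)) (M' : 'M[R]_(n, p)) :
  f @ F --> M -> g @ F --> M' -> (f x *m g x) @[x --> F] --> M *m M'.
Proof.
move=> /cvg_mxP fM /cvg_mxP gM'; apply/cvg_mxP => i j; rewrite mxE.
under eq_fun do rewrite mxE.
by apply: (@cvg_sum R^o) => k; exact: cvgM.
Qed.

Lemma cvg_sqnormW P k (W : 'M[R]_P) (f : T -> 'M[R]_(P, k))
    (M : 'M[R]_(P, k)) :
  f @ F --> M -> sqnormW W (f x) @[x --> F] --> sqnormW W M.
Proof.
move=> fM; have /cvg_mxP fE := fM; rewrite /sqnormW; apply: (@cvg_sum R^o) => i.
suff /cvg_mxP : (f x)^T *m W *m f x @[x --> F] --> M^T *m W *m M by exact.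
apply: cvg_mulmx fM; apply: cvg_mulmx; last exact: cvg_cst.
apply/cvg_mxP => a b; rewrite mxE; under eq_fun do rewrite mxE.
exact: fE.
Qed.

End MatrixLimits.

(** * Derivatives within a set *)

Section DerivativeWithin.
Context {R : realType}.

(** The relational form avoids [lim], whose value is meaningful only when the
    filter of admissible increments is proper. *)
Definition has_derivative_within {V W : normedModType R} (K : set V)
    (f : V -> W) (v x : V) (l : W) : Prop :=
  diff_quotient f x v @ within [set h | K (x + h *: v)] 0^' --> l.

Lemma has_derivative_within_mxP {V : normedModType R} m n (K : set V)
    (f : V -> 'M[R]_(m, n)) v x (l : 'M[R]_(m, n)) :
  has_derivative_within K f v x l <->
  forall i j, has_derivative_within K (fun y => f y i j : R^o) v x (l i j).
Proof.
have E i j : (fun h => diff_quotient f x v h i j) =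
    diff_quotient (fun y => f y i j : R^o) x v.
  by apply/funext => h; rewrite /diff_quotient !mxE.
rewrite /has_derivative_within; split.
  by move=> /cvg_mxP fl i j; rewrite -E; exact: fl.
by move=> fl; apply/cvg_mxP => i j; rewrite E; exact: fl.
Qed.

Lemma eq_has_derivative_within {V W : normedModType R} (K : set V)
    (f g : V -> W) v x l : K x -> (forall y, K y -> f y = g y) ->
  has_derivative_within K f v x l -> has_derivative_within K g v x l.
Proof.
move=> Kx fg; apply: cvg_trans; apply: near_eq_cvg.
by near=> h; rewrite /diff_quotient !fg//; near: h; exact: withinT.
Unshelve. all: by end_near. Qed.

Local Notation I := (unit_interval : set R^o).

Lemma cvg_rescale_within {V : normedModType R} (K : set V) (x v : V) (c : R) :
  c != 0 ->
  h * c @[h --> within [set h | K (x + h *: (c *: v))] 0^'] -->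
  within [set h | K (x + h *: v)] 0^'.
Proof.
move=> c0 A; rewrite /within /dnbhs /= => A0.
have hc : h * c @[h --> (0 : R)] --> (0 : R).
  rewrite -[X in _ --> X](mul0r c).
  exact: (@cvgM R R (nbhs 0) _ id (cst c) 0 c cvg_id (cvg_cst _)).
have := hc _ A0; apply: (@filterS _ (nbhs (0 : R))) => h hA h0 /=.
by rewrite scalerA => Kh; apply: hA => //; rewrite mulf_neq0.
Qed.

(** [0, 1] has admissible nonzero increments at each of its points, in each
    direction; hence limits of difference quotients are unique.  This is what
    turns a limit into a value of [derive_within]. *)
Lemma unit_interval_increments_proper (t v : R^o) : I t ->
  ProperFilter (within [set h : R | I (t + h *: v)] 0^').
Proof.
move=> It; apply: Build_ProperFilter_ex => A.
have [->|v0] := eqVneq v 0.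
  move=> A0; suff /(@filter_ex _ (0 : R)^')[h hA] : (0 : R)^' A by exists h.
  by move: A0; apply: (@filterS _ (0 : R)^') => h; apply; rewrite /= scaler0 addr0.
wlog -> : v v0 A / v = 1.
  move=> wlg Av.
  have w1 : v^-1 *: v = 1 by rewrite /GRing.scale/= mulVf.
  have w0 : v^-1 *: v != 0 by rewrite w1 oner_neq0.
  have [h hA] := wlg _ w0 _ w1 (@cvg_rescale_within R^o I t v _ (invr_neq0 v0) _ Av).
  by exists (h * v^-1).
rewrite /within /dnbhs /= => /nbhs_ballP[e /= e0 eA].
pose a : R := Num.min 2^-1 (e / 2).
have a0 : 0 < a by rewrite lt_min ?divr_gt0// invr_gt0 ltr0n.
have ae : a < e by rewrite gt_min [X in _ || X]ltr_pdivrMr// ltr_pMr// ltr1n orbT.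
have a1 : a <= 2^-1 by rewrite ge_min lexx.
(* The increment a or - a goes towards the far half of the interval. *)
have aB d : `|d| = a -> A (d : R) \/ ~ I (t + d *: 1).
  move=> da; have [Id|] := pselect (I (t + d *: 1)); [left|by right].
  apply: eA => //; first by rewrite /ball/= sub0r normrN da.
  by rewrite -normr_gt0 da.
move: It; rewrite /unit_interval /= in_itv/= => /andP[t0 t1].
have [tt|tt] := leP t 2^-1.
  have [Aa|[]] := aB a (gtr0_norm a0); first by exists a.
  rewrite /unit_interval /= in_itv/= /GRing.scale /= mulr1.
  by apply/andP; split; lra.
have [Aa|[]] := aB (- a) (etrans (normrN a) (gtr0_norm a0)); first by exists (- a).
rewrite /unit_interval /= in_itv/= /GRing.scale /= mulr1.
by apply/andP; split; lra.
Qed.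

(** The class C^n asks for derivatives in all directions of the line; they are
    multiples of the one along 1, by rescaling the increment. *)
Lemma time_derivative_scale {W : normedModType R} (g : R^o -> W) (t v : R^o) l :
  has_derivative_within I g 1 t l -> has_derivative_within I g v t (v *: l).
Proof.
move=> gl; rewrite /has_derivative_within.
have [->|v0] := eqVneq v 0.
  rewrite scale0r (_ : diff_quotient _ _ _ = cst 0); first exact: cvg_cst.
  by apply/funext => h; rewrite /diff_quotient scaler0 addr0 subrr scaler0.
have -> : diff_quotient g t v = (fun h => v *: diff_quotient g t 1 (h * v)).
  apply/funext => h; rewrite /diff_quotient scalerA.
  rewrite invfM mulrCA divff// mulr1; congr (_ *: (g (_ + _) - _)).
  by rewrite /GRing.scale /= mulr1.
apply: cvgZ; first exact: cvg_cst.
have := @cvg_rescale_within R^o I t 1 v v0.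
rewrite (_ : v *: 1 = v); last by rewrite /GRing.scale/= mulr1.
by move=> /cvg_comp; apply.
Qed.

Lemma time_derivative_eq {W : normedModType R} (g : R^o -> W) (t v : R^o) l :
  I t -> has_derivative_within I g 1 t l ->
  derivable_within I g v t /\ derive_within I g v t = v *: l.
Proof.
move=> It /(@time_derivative_scale _ _ _ v) gl.
have := unit_interval_increments_proper v It => ?.
by split; [apply/cvg_ex; exists (v *: l)|exact: cvg_lim].
Qed.

(** * Class C^n on the unit interval *)

(** [derive_within] takes unspecified values off K, so that a derivative computed
    by hand agrees with it on K only; class C^n does not see the difference. *)
Lemma class_C_ext {V W : normedModType R} n (K : set V) (f g : V -> W) :
  (forall y, K y -> f y = g y) -> class_C n K f -> class_C n K g.
Proof.
have cont (u w : V -> W) : (forall y, K y -> u y = w y) ->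
    {within K, continuous u} -> {within K, continuous w}.
  move=> uw /subspace_continuousP cu; apply/subspace_continuousP => x Kx.
  suff : w @ within K (nbhs x) --> u x by rewrite (uw x Kx).
  apply: cvg_trans (cu x Kx); apply: near_eq_cvg.
  by near=> y; apply: uw; near: y; exact: withinT.
have quot (u w : V -> W) v x : K x -> (forall y, K y -> u y = w y) ->
    diff_quotient w x v @ within [set h | K (x + h *: v)] 0^' =
    diff_quotient u x v @ within [set h | K (x + h *: v)] 0^'.
  move=> Kx uw; apply/seteqP; split; apply: near_eq_cvg; near=> h;
    by rewrite /diff_quotient !uw//; near: h; exact: withinT.
elim: n f g => [|n IHn] f g fg /= [cf df]; split; try exact: cont fg cf.
  by [].
move=> v; have [dfv Cfv] := df v; split.
  by move=> x Kx; rewrite /derivable_within (quot f g)//; exact: dfv.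
by apply: IHn Cfv => y Ky; rewrite /derive_within (quot f g).
Unshelve. all: by end_near. Qed.

Lemma class_C_succ {W : normedModType R} n (g g' : R^o -> W) :
  {within I, continuous g} ->
  (forall t, I t -> has_derivative_within I g 1 t (g' t)) ->
  (forall v : R, class_C n I (fun t => v *: g' t)) ->
  class_C n.+1 I g.
Proof.
move=> cg dg Cg' /=; split=> // v; split=> [x Ix|].
  exact: (time_derivative_eq v Ix (dg _ Ix)).1.
apply: class_C_ext (Cg' v) => y Iy.
by rewrite (time_derivative_eq v Iy (dg _ Iy)).2.
Qed.

Lemma class_C2_time {W : normedModType R} (g g' g'' : R^o -> W) :
  {within I, continuous g} -> {within I, continuous g'} ->
  {within I, continuous g''} ->
  (forall t, I t -> has_derivative_within I g 1 t (g' t)) ->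
  (forall t, I t -> has_derivative_within I g' 1 t (g'' t)) ->
  class_C 2 I g.
Proof.
have cZ v (u : R^o -> W) : {within I, continuous u} ->
    {within I, continuous (fun t => v *: u t)}.
  by move=> cu x; apply: cvgZ; [exact: cvg_cst|exact: cu].
move=> cg cg' cg'' dg dg'; apply: (class_C_succ cg dg) => v.
apply: (@class_C_succ _ _ _ (fun t => v *: g'' t)) => [|t It|w].
- exact: cZ.
- rewrite /has_derivative_within.
  rewrite (_ : diff_quotient _ _ _ = fun h => v *: diff_quotient g' t 1 h).
    by apply: cvgZ; [exact: cvg_cst|exact: dg'].
  apply/funext => h; rewrite /diff_quotient -scalerBr !scalerA.
  by rewrite mulrC.
- by split=> //; apply: (cZ _ _ (cZ _ _ cg'')).
Qed.

(** * Mean value theorem along an invariant direction *)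

Lemma mean_value_along {V : normedModType R} (K : set V) (F D : V -> R^o) (e : V) :
  (forall y s, K y -> K (y + s *: e)) ->
  (forall y, K y -> has_derivative_within K F e y (D y)) ->
  forall (y : V) (s : R), K y -> exists2 xi : R, `|xi| <= `|s| &
    (F (y + s *: e) - F y = s * D (y + xi *: e) :> R).
Proof.
move=> Ke dF y s Ky.
pose phi (r : R) : R := F (y + r *: e).
have dphi r : is_derive r (1 : R) (phi : R -> R^o) (D (y + r *: e)).
  have dr := dF _ (Ke y r Ky).
  (* K is invariant along e, so the one-dimensional derivative is two-sided. *)
  have WE : within [set h : R | K (y + r *: e + h *: e)] 0^' = (0 : R)^'.
    apply/seteqP; split=> A /=.
      by rewrite /within /=; apply: filterS => h; apply; exact: (Ke _ _ (Ke _ _ Ky)).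
    by apply: (@filterS _ (0 : R)^').
  have E : (fun h : R => h^-1 *: ((phi \o shift r) (h *: 1) - phi r) : R^o) @ 0^' -->
      D (y + r *: e).
    have -> : (fun h : R => h^-1 *: ((phi \o shift r) (h *: 1) - phi r) : R^o) =
        diff_quotient F (y + r *: e) e.
      apply/funext => h; rewrite /diff_quotient /phi /=.
      have h1 : h *: (1 : R) = h by rewrite /GRing.scale/= mulr1.
      by rewrite h1 -addrA -scalerDl [r + h]addrC.
    by move: dr; rewrite /has_derivative_within WE.
  apply: DeriveDef; first by apply/cvg_ex; exists (D (y + r *: e)).
  exact: cvg_lim E.
have cphi a b : {within `[a, b], continuous phi}.
  by apply: derivable_within_continuous => r _; exact: ex_derive.
have E0 : F (y + s *: e) - F y = phi s - phi 0 by rewrite /phi scale0r addr0.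
have [s0|s0] := leP 0 s.
  have [c + cE] := MVT_segment s0 (fun r _ => dphi r) (cphi _ _).
  rewrite in_itv/= => /andP[c0 cs]; exists c.
    by rewrite !ger0_norm.
  by rewrite E0 cE subr0 mulrC.
have [c + cE] := MVT_segment (ltW s0) (fun r _ => dphi r) (cphi _ _).
rewrite in_itv/= => /andP[cs c0]; exists c.
  by rewrite !ler0_norm ?lerN2// ltW.
by rewrite E0 -[LHS]opprB cE sub0r mulrN opprK mulrC.
Qed.

Lemma within_continuous_cvg {V W : topologicalType} (K : set V) (f : V -> W)
    {T : Type} {G : set_system T} {FG : Filter G} (u : T -> V) (x : V) :
  {within K, continuous f} -> K x -> (\forall h \near G, K (u h)) ->
  u @ G --> x -> f (u h) @[h --> G] --> f x.
Proof.
move=> /subspace_continuousP cf Kx Ku ux.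
have uK : u h @[h --> G] --> within K (nbhs x).
  by move=> A /= /ux; apply: filterS2 Ku => h Kh; apply.
exact: (cvg_comp _ _ uK (cf x Kx)).
Qed.

(** A strict form of differentiability: the base point y h may vary with h as
    long as it tends to x, and D x still is the limit slope.  The slope c h is the
    derivative at an intermediate point, which tends to x with y h and s h. *)
Lemma slope_along {V : normedModType R} (K : set V) (F D : V -> R^o) (e x : V)
    {T : Type} {G : set_system T} {FG : Filter G} (y : T -> V) (s : T -> R) :
  (forall y s, K y -> K (y + s *: e)) ->
  (forall y, K y -> has_derivative_within K F e y (D y)) ->
  {within K, continuous D} ->
  K x -> (\forall h \near G, K (y h)) -> y @ G --> x -> s @ G --> (0 : R) ->
  exists c : T -> R,
    (\forall h \near G, F (y h + s h *: e) - F (y h) = s h * c h :> R) /\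
    c @ G --> (D x : R).
Proof.
move=> Ke dF cD Kx Ky yx s0.
have /choice[xi xiP] : forall h, exists xi : R, (`|xi| <= `|s h|) /\
    (K (y h) -> F (y h + s h *: e) - F (y h) =
      s h * D (y h + xi *: e) :> R).
  move=> h; have [Kh|nK] := pselect (K (y h)).
    by have [c [? ?]] := mean_value_along Ke dF (s h) Kh; exists c.
  by exists 0; rewrite normr0.
exists (fun h => D (y h + xi h *: e)); split.
  by apply: filterS Ky => h; exact: (xiP h).2.
have xi0 : xi @ G --> (0 : R).
  apply/norm_cvg0P; apply: (@squeeze_cvgr _ _ _ _ (cst 0) (fun h => `|s h|)).
  - by near=> h; rewrite normr_ge0 (xiP h).1.
  - exact: cvg_cst.
  - by rewrite -(@normr0 _ R); exact: cvg_norm.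
have zx : y h + xi h *: e @[h --> G] --> x.
  rewrite -[X in _ --> X]addr0 -(scale0r e); apply: cvgD => //.
  by apply: cvgZ => //; exact: cvg_cst.
apply: (within_continuous_cvg cD) zx => //.
by apply: filterS Ky => h; exact: Ke.
Unshelve. all: by end_near. Qed.

End DerivativeWithin.

(** * Product and chain rules in time *)

Section ChainRule.
Context {R : realType}.
Local Notation I := (unit_interval : set R^o).

Lemma cvg_time_increment (t : R^o) {W : topologicalType} (g : R^o -> W) :
  I t -> {within I, continuous g} ->
  g (t + h *: 1) @[h --> within [set h : R | I (t + h *: 1)] 0^'] --> g t.
Proof.
move=> It cg; apply: (within_continuous_cvg cg) => //; first exact: withinT.
apply: cvg_within_filter.
suff : t + h *: (1 : R^o) @[h --> (0 : R)^'] --> t + (0 : R) *: (1 : R^o).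
  by rewrite scale0r addr0.
apply: cvgD; first exact: cvg_cst.
by apply: cvgZ; [exact: nbhs_dnbhs|exact: cvg_cst].
Qed.

Lemma time_derivative_mulmx m n p (A : R^o -> 'M[R]_(m, n))
    (B : R^o -> 'M[R]_(n, p)) (A' : 'M[R]_(m, n)) (B' : 'M[R]_(n, p)) (t : R^o) :
  I t -> {within I, continuous B} ->
  has_derivative_within I A 1 t A' -> has_derivative_within I B 1 t B' ->
  has_derivative_within I (fun s => A s *m B s) 1 t (A' *m B t + A t *m B').
Proof.
move=> It cB dA dB; rewrite /has_derivative_within.
have -> : diff_quotient (fun s => A s *m B s) t 1 =
    (fun h => diff_quotient A t 1 h *m B (t + h *: 1) +
              A t *m diff_quotient B t 1 h).
  apply/funext => h; rewrite /diff_quotient -scalemxAl -scalemxAr -scalerDr.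
  by rewrite mulmxBl mulmxBr addrA subrK.
apply: cvgD; first by apply: cvg_mulmx => //; exact: cvg_time_increment.
by apply: cvg_mulmx => //; exact: cvg_cst.
Qed.

(** The increment of F splits into a time step at the fixed position q(t) and
    one step per position coordinate at the fixed time t + h.  Divided by h, the
    first tends to the time derivative of F, the k-th of the others to q'_k times
    the k-th partial derivative by [slope_along]. *)
Lemma time_derivative_chain_scalar N (F : 'cV[R]_N * R^o -> R^o)
    (D : 'cV[R]_N * R^o -> 'cV[R]_N * R^o -> R^o)
    (q : R^o -> 'cV[R]_N) (q' : 'cV[R]_N) (t : R^o) :
  let K := [set x : 'cV[R]_N * R^o | I x.2] in
  I t -> {within I, continuous q} -> has_derivative_within I q 1 t q' ->
  (forall v x, K x -> has_derivative_within K F v x (D v x)) ->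
  (forall v, {within K, continuous (D v)}) ->
  has_derivative_within I (fun s => F (q s, s)) 1 t
    (D (0, 1) (q t, t) +
     \sum_(k < N) q' k 0 * D (delta_mx k 0, 0) (q t, t)).
Proof.
move=> K It cq dq dF cD.
set G := within [set h : R | I (t + h *: 1)] 0^'.
(* Position after the first k of the coordinate steps from q(t) to q(t + h). *)
pose pos (k : nat) (h : R) : 'cV[R]_N :=
  \col_i (if (i < k)%N then q (t + h *: 1) i 0 else q t i 0).
pose step (k : 'I_N) (h : R) : R := q (t + h *: 1) k 0 - q t k 0.
have GI : \forall h \near G, I (t + h *: 1) by exact: withinT.
have qG i : q (t + h *: 1) i 0 @[h --> G] --> q t i 0.
  by have /cvg_mxP := cvg_time_increment It cq; exact.
have posG k : pos k h @[h --> G] --> q t.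
  apply/cvg_mxP => i j; rewrite (ord1 j).
  under eq_fun do rewrite mxE.
  by case: (i < k)%N; [exact: qG|exact: cvg_cst].
have stepG k : step k h @[h --> G] --> (0 : R).
  rewrite -(subrr (q t k 0)); apply: (@cvgB _ R^o); first exact: qG.
  exact: cvg_cst.
have timeG : (t + h *: 1 : R^o) @[h --> G] --> t.
  apply: (@cvg_time_increment t R^o id It).
  by apply: continuous_subspaceT => x; exact: cvg_id.
have posS (k : 'I_N) h : (pos k.+1 h, t + h *: 1) =
    (pos k h, t + h *: 1) + step k h *: (delta_mx k 0, 0) :> 'cV[R]_N * R^o.
  congr pair => /=; last by rewrite scaler0 addr0.
  apply/matrixP => i j; rewrite !mxE (ord1 j) eqxx andbT ltnS leq_eqVlt.
  have [->|ik] := eqVneq i k; first by rewrite ltnn eqxx /= mulr1 /step addrC subrK.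
  by rewrite (negbTE (ik : val i != val k)) /= mulr0 addr0.
have /choice[c cP] : forall k : 'I_N, exists c : R -> R,
    (\forall h \near G, F (pos k.+1 h, t + h *: 1) - F (pos k h, t + h *: 1)
                        = step k h * c h :> R) /\
    c @ G --> (D (delta_mx k 0, 0) (q t, t) : R).
  move=> k.
  have Kk (y : 'cV[R]_N * R^o) (s : R) : K y -> K (y + s *: (delta_mx k 0, 0)).
    by rewrite /K /= scaler0 addr0.
  have pG : (pos k h, t + h *: 1 : R^o) @[h --> G] --> (q t, t).
    exact: (cvg_pair (posG k) timeG).
  have Kt : K (q t, t) by [].
  have [c [cE cl]] := slope_along Kk (dF _) (cD _) Kt GI pG (stepG k).
  by exists c; split=> //; apply: filterS cE => h <-; rewrite posS.
rewrite /has_derivative_within -/G.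
have quotE : {near G, (fun h => diff_quotient F (q t, t) (0, 1) h +
      \sum_(k < N) diff_quotient q t 1 h k 0 * c k h) =1
    diff_quotient (fun s => F (q s, s)) t 1}.
  have cE : \forall h \near G, forall k : 'I_N,
      F (pos k.+1 h, t + h *: 1) - F (pos k h, t + h *: 1) = step k h * c k h :> R.
    by apply: filter_forall => k; exact: (cP k).1.
  apply: filterS cE => h cE; rewrite /diff_quotient.
  under eq_bigr => k _ do rewrite !mxE -mulrA -[X in _ * X]cE.
  rewrite -mulr_sumr -scalerDr; congr (_ *: _).
  rewrite -(big_mkord predT
    (fun k => F (pos k.+1 h, t + h *: 1) - F (pos k h, t + h *: 1))).
  rewrite telescope_sumr//.
  have -> : pos N h = q (t + h *: 1).
    by apply/matrixP => i j; rewrite mxE (ord1 j) ltn_ord.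
  have -> : pos 0 h = q t by apply/matrixP => i j; rewrite mxE (ord1 j).
  rewrite (_ : (q t, t) + _ = (q t, t + h *: 1)); last first.
    by congr pair => /=; rewrite scaler0 addr0.
  by rewrite addrC addrA subrK.
apply: (cvg_trans (near_eq_cvg quotE)).
apply: cvgD.
  exact: dF.
apply: cvg_sum => k; apply: cvgM; last exact: (cP k).2.
by move/cvg_mxP : dq; exact.
Qed.

Lemma time_derivative_chain N m n (A : 'cV[R]_N * R^o -> 'M[R]_(m, n))
    (D : 'cV[R]_N * R^o -> 'cV[R]_N * R^o -> 'M[R]_(m, n))
    (q : R^o -> 'cV[R]_N) (q' : 'cV[R]_N) (t : R^o) :
  let K := [set x : 'cV[R]_N * R^o | I x.2] in
  I t -> {within I, continuous q} -> has_derivative_within I q 1 t q' ->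
  (forall v x, K x -> has_derivative_within K A v x (D v x)) ->
  (forall v, {within K, continuous (D v)}) ->
  has_derivative_within I (fun s => A (q s, s)) 1 t
    (D (0, 1) (q t, t) + \sum_(k < N) q' k 0 *: D (delta_mx k 0, 0) (q t, t)).
Proof.
move=> K It cq dq dA cD; apply/has_derivative_within_mxP => i j.
rewrite mxE summxE; under eq_bigr => k _ do rewrite mxE.
apply: (@time_derivative_chain_scalar N (fun x => A x i j)
  (fun v x => D v x i j)) => //.
  by move=> v x /dA - /(_ v) /has_derivative_within_mxP; exact.
by move=> v x; have /cvg_mxP := cD v x; exact.
Qed.

End ChainRule.

(** * Fundamental theorem of calculus up to the endpoints *)

Section FTC.
Context {R : realType}.
Local Notation I := (unit_interval : set R^o).
Local Notation mu := lebesgue_measure.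

(** The retraction of the line onto [0, 1]: precomposing with it extends a
    function continuous on [0, 1] to one continuous on the line, so that the
    endpoints become interior points. *)
Definition clamp (s : R) : R := Num.max 0 (Num.min 1 s).

Lemma clampI s : I (clamp s).
Proof.
rewrite /unit_interval /= in_itv /= /clamp le_max lexx /= ge_max ler01 /=.
by rewrite ge_min lexx.
Qed.

Lemma clamp_id s : I s -> clamp s = s.
Proof.
by rewrite /unit_interval /= in_itv/= /clamp => /andP[s0 s1]; rewrite min_r ?max_r.
Qed.

Lemma clamp_continuous : continuous clamp.
Proof.
move=> s; apply: (@continuous_max R R (cst 0) (fun x => Num.min 1 x)).
  exact: cvg_cst.
by apply: (@continuous_min R R (cst 1) id); [exact: cvg_cst|exact: cvg_id].
Qed.

Lemma continuous_clamp (g : R -> R) :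
  {within I, continuous g} -> continuous (g \o clamp).
Proof.
move=> cg s; apply: (within_continuous_cvg cg (clampI s)).
  by near=> x; exact: clampI.
exact: clamp_continuous.
Unshelve. all: by end_near. Qed.

Lemma unit_interval_integrable (g : R -> R) :
  {within I, continuous g} -> mu.-integrable (unit_interval : set R) (EFin \o g).
Proof.
by move=> cg; apply: continuous_compact_integrable => //; exact: segment_compact.
Qed.

Lemma time_derivative_integral (g : R -> R) (t : R) :
  I t -> {within I, continuous g} ->
  has_derivative_within I (fun s => (\int[mu]_(x in `[0, s]) g x : R^o)) 1 t (g t).
Proof.
move=> It cg.
pose G := g \o clamp.
have cG : continuous G by exact: continuous_clamp.
have iG a b : mu.-integrable `[a, b] (EFin \o G).
  apply: continuous_compact_integrable; first exact: segment_compact.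
  exact: continuous_subspaceT.
(* Any base point to the left of 0 makes 0 an interior point for F. *)
pose F (y : R) : R := \int[mu]_(x in `[-1, y]) G x.
have FE s : I s -> \int[mu]_(x in `[0, s]) g x = F s - F 0.
  move=> Is; have := Is; rewrite /unit_interval /= in_itv/= => /andP[s0 s1].
  rewrite /F Rintegral_itvB; last 3 first.
  - exact: iG.
  - by rewrite bnd_simp lerN10.
  - by rewrite bnd_simp.
  rewrite Rintegral_itv_obnd_cbnd; last first.
    by apply: integrableS (iG 0 s) => //; exact: subset_itv_oc_cc.
  apply: eq_Rintegral => x; rewrite inE /= in_itv/= => /andP[x0 xs].
  rewrite /G /= clamp_id// /unit_interval /= in_itv/= x0.
  exact: le_trans xs s1.
have := It; rewrite /unit_interval /= in_itv/= => /andP[t0 t1].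
have tt : t < t + 1 by rewrite ltrDl.
have m1t : -1 < t by rewrite (lt_le_trans _ t0)// ltrN10.
have [dF F't] : derivable F t 1 /\ derive1 F t = G t.
  exact: (continuous_FTC1_closed tt (iG _ _) m1t (cG t)).
have dG : has_derivative_within I (fun s => F s - F 0 : R^o) 1 t (g t).
  have -> : g t = derive1 F t by rewrite F't /G /= clamp_id.
  rewrite derive1E; apply: cvg_within_filter.
  have -> : diff_quotient (fun s => F s - F 0 : R^o) t 1 =
      fun h => h^-1 *: ((F \o shift t) (h *: 1) - F t).
    apply/funext => h; rewrite /diff_quotient /= [h *: 1 + t]addrC.
    by rewrite opprB addrA subrK.
  exact: dF.
by apply: eq_has_derivative_within dG => // s Is; rewrite FE.
Qed.

Lemma time_derivative_integral_vec n (g : R -> 'cV[R]_n) (b : 'cV[R]_n) (t : R) :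
  I t -> {within I, continuous g} ->
  has_derivative_within I (fun s : R => b + integral_vec `[0, s] g) 1 t (g t).
Proof.
move=> It cg; rewrite /has_derivative_within.
have -> : diff_quotient (fun s : R => b + integral_vec `[0, s] g) t 1 =
    diff_quotient (fun s : R => integral_vec `[0, s] g) t (1 : R^o).
  by apply/funext => h; rewrite /diff_quotient opprD addrACA subrr add0r.
apply/has_derivative_within_mxP => i j.
have cgij : {within I, continuous (fun s => g s i j)}.
  by move=> s; have /cvg_mxP := cg s; exact.
have := time_derivative_integral It cgij.
apply: eq_has_derivative_within => // s Is.
by rewrite mxE (ord1 j).
Qed.

Lemma continuous_integral_vec n (g : R -> 'cV[R]_n) (b : 'cV[R]_n) :
  {within I, continuous g} ->
  {within I, continuous (fun s : R => b + integral_vec `[0, s] g)}.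
Proof.
move=> cg t; apply: cvgD; first exact: cvg_cst.
apply/cvg_mxP => i j; rewrite mxE; under eq_fun do rewrite mxE.
have cgi : {within I, continuous (fun s => g s i 0)}.
  by move=> s; have /cvg_mxP := cg s; exact.
exact: (parameterized_integral_continuous ler01 (unit_interval_integrable cgi)).
Qed.

End FTC.

(** * Trajectories and the two functionals *)

Section Trajectories.
Context {R : realType} {N P : nat}.
Local Notation I := (unit_interval : set R^o).

Lemma trajectory_derivatives n (q : R -> 'cV[R]_n) : trajectory q ->
  [/\ {within I, continuous q}, {within I, continuous (time_derivative q)},
      {within I, continuous (time_derivative (time_derivative q))},
      forall t, I t -> has_derivative_within I q 1 t (time_derivative q t) &
      forall t, I t -> has_derivative_within I (time_derivative q) 1 t
        (time_derivative (time_derivative q) t)].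
Proof.
move=> [cq Dq]; have [dq [cq' Dq']] := Dq 1; have [dq' [cq'' _]] := Dq' 1.
split.
- exact: cq.
- exact: cq'.
- exact: cq''.
- exact: dq.
- exact: dq'.
Qed.

Lemma continuous_along_trajectory (V W : normedModType R) (K : set V) (F : V -> W)
    (u : R^o -> V) :
  {within K, continuous F} -> (forall t, I t -> K (u t)) ->
  {within I, continuous u} -> {within I, continuous (fun t => F (u t))}.
Proof.
move=> cF Ku /subspace_continuousP cu; apply/subspace_continuousP => t It.
apply: (within_continuous_cvg cF (Ku t It)); last exact: cu.
by apply: filterS (withinT _ _) => s; exact: Ku.
Qed.

Lemma continuous_pair_time (V : normedModType R) (q : R^o -> V) :
  {within I, continuous q} -> {within I, continuous (fun t => (q t, t) : V * R^o)}.
Proof.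
move=> cq; apply/subspace_continuousP => t It.
apply: (@cvg_pair _ _ _ _ (nbhs (q t)) (nbhs t)); last exact: cvg_within.
by move/subspace_continuousP : cq; exact.
Qed.

Lemma sqnormW_ge0 (W : 'M[R]_P) (B : 'cV[R]_P) : symmetric_posdef W ->
  0 <= sqnormW W B.
Proof.
move=> [_ posW]; rewrite /sqnormW trace_mx11.
by have [->|/posW/ltW//] := eqVneq B 0; rewrite mulmx0 mxE.
Qed.

Lemma sqnormW0 k (W : 'M[R]_P) : sqnormW W (0 : 'M[R]_(P, k)) = 0.
Proof. by rewrite /sqnormW mulmx0 mxtrace0. Qed.

(** Product rule and chain rule give the derivative
    (d/dt A(q, t)) q' + A(q, t) q''; it is continuous because q, q', q'', A and
    the first derivatives of A are. *)
Lemma velocity_image_C1 (A : 'cV[R]_N -> R -> 'M[R]_(P, N))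
    (q : R -> 'cV[R]_N) :
  C2_matrix_field A -> trajectory q ->
  {within I, continuous (fun t => A (q t) t *m time_derivative q t)} /\
  exists2 g' : R -> 'cV[R]_P, {within I, continuous g'} &
    forall t, I t -> has_derivative_within I
      (fun t => A (q t) t *m time_derivative q t) 1 t (g' t).
Proof.
move=> [cA dA] /trajectory_derivatives[cq cq' cq'' dq dq'].
pose K := [set x : 'cV[R]_N * R^o | I x.2].
pose DA (v x : 'cV[R]_N * R^o) := derive_within K (fun x => A x.1 x.2) v x.
have cDA v : {within K, continuous (DA v)} by have [_ []] := dA v.
have dDA v x : K x -> has_derivative_within K (fun x => A x.1 x.2) v x (DA v x).
  by move=> Kx; have [d _] := dA v; exact: d.
have along (W : normedModType R) (F : 'cV[R]_N * R^o -> W) :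
    {within K, continuous F} -> {within I, continuous (fun t => F (q t, t))}.
  move=> cF; apply: (continuous_along_trajectory cF) => //.
  exact: continuous_pair_time.
have cAq := along _ _ cA.
split; first by move=> t; apply: cvg_mulmx; [exact: cAq|exact: cq'].
pose A' t := DA (0, 1) (q t, t) +
  \sum_(k < N) time_derivative q t k 0 *: DA (delta_mx k 0, 0) (q t, t).
exists (fun t => A' t *m time_derivative q t +
                 A (q t) t *m time_derivative (time_derivative q) t).
  move=> t; apply: cvgD; apply: cvg_mulmx; [|exact: cq'|exact: cAq|exact: cq''].
  apply: cvgD; first exact: (along _ _ (cDA _)).
  apply: cvg_sum => k; apply: cvgZ; last exact: (along _ _ (cDA _)).
  by have /cvg_mxP := cq' t; exact.
move=> t It; apply: (time_derivative_mulmx It cq'); last exact: dq'.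
exact: (time_derivative_chain It cq (dq t It) dDA cDA).
Qed.

End Trajectories.

Section Functionals.
Context {R : realType} {N P : nat}.
Context {f1 : 'cV[R]_N -> 'cV[R]_N -> R -> R} {A : 'cV[R]_N -> R -> 'M[R]_(P, N)}.
Context (hA : C2_matrix_field A).
Local Notation I := (unit_interval : set R^o).

Lemma theta_star_time_derivative q b t : trajectory q -> I t ->
  has_derivative_within I (theta_star A q b) 1 t (A (q t) t *m time_derivative q t).
Proof.
move=> hq It; apply: (@time_derivative_integral_vec R _
  (fun s => A (q s) s *m time_derivative q s)) => //.
exact: (velocity_image_C1 hA hq).1.
Qed.

Lemma trajectory_theta_star q b : trajectory q -> trajectory (theta_star A q b).
Proof.
move=> hq; have [cg [g' cg' dg]] := velocity_image_C1 hA hq.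
have dth t := @theta_star_time_derivative q b t hq.
apply: (@class_C2_time R _ (theta_star A q b) _ g') => //.
exact: continuous_integral_vec.
Qed.

Lemma continuous_lagrangian q : C2_lagrangian f1 -> trajectory q ->
  {within I, continuous (fun t => f1 (q t) (time_derivative q t) t)}.
Proof.
move=> [cf _] /trajectory_derivatives[cq cq' _ _ _].
apply: (@continuous_along_trajectory R ('cV[R]_N * 'cV[R]_N * R^o)%type R^o _ _
  (fun t => (q t, time_derivative q t, t)) cf) => //.
apply: (@continuous_pair_time R ('cV[R]_N * 'cV[R]_N)%type
  (fun t => (q t, time_derivative q t))) => t.
apply: (@cvg_pair _ _ _ _ (nbhs (q t)) (nbhs (time_derivative q t))).
  exact: cq.
exact: cq'.
Qed.

(** Both integrands are continuous on [0, 1], hence integrable, so that the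
    pointwise inequality passes to the integrals. *)
Lemma J1_le_J2 W q theta : C2_lagrangian f1 -> symmetric_posdef W ->
  trajectory q -> trajectory theta -> J1 f1 q <= J2 f1 A W theta q.
Proof.
move=> hf hW hq hth.
have cf := continuous_lagrangian hf hq.
have [_ cth' _ _ _] := trajectory_derivatives hth.
have [cg _] := velocity_image_C1 hA hq.
apply: le_Rintegral.
- exact: measurable_itv.
- exact: (unit_interval_integrable cf).
- apply: (@unit_interval_integrable R (fun t => _ + _)) => t.
  apply: cvgD; first exact: cf.
  apply: cvgM; first exact: cvg_cst.
  by apply: cvg_sqnormW; apply: cvgB; [exact: cth'|exact: cg].
- by move=> t _; rewrite lerDl mulr_ge0// ?invr_ge0//; exact: sqnormW_ge0.
Qed.

Lemma J2_theta_star W q b : trajectory q -> J2 f1 A W (theta_star A q b) q = J1 f1 q.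
Proof.
move=> hq; apply: eq_Rintegral => t; rewrite inE => It.
have [_] := time_derivative_eq 1 It (theta_star_time_derivative b hq It).
by rewrite scale1r /time_derivative => ->; rewrite subrr sqnormW0 mulr0 addr0.
Qed.

End Functionals.

Theorem theorem3p1 (R : realType) (N P : nat)
  (f1 : 'cV[R]_N -> 'cV[R]_N -> R -> R)
  (A : 'cV[R]_N -> R -> 'M[R]_(P, N))
  (W : 'M[R]_P)
  (q0 q1 : 'cV[R]_N)
  (qstar : R -> 'cV[R]_N)
  (hf1 : C2_lagrangian f1)
  (hA : C2_matrix_field A)
  (hW : symmetric_posdef W)
  (hext : extremal_J1 f1 qstar)
  (hmin : global_minimizer_J1 f1 q0 q1 qstar) :
  forall b : 'cV[R]_P,
    global_minimizer_J2 f1 A W q0 q1 qstar (theta_star A qstar b).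
Proof.
move=> b; case: hmin => adm min_q; have [hq _ _] := adm.
split; [exact: adm|exact: trajectory_theta_star|].
move=> q theta hadm htheta; rewrite (J2_theta_star hA W b hq).
have [hq' _ _] := hadm; apply: (le_trans (min_q _ hadm)).
exact: (J1_le_J2 hA hf1 hW hq' htheta).
Qed.
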